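(* (In ZFC.) There exists a subspace of $(\omega+1)\times\omega_1$ that is semi-proximal and not normal.
   Context: The ordinals $\omega+1$ and $\omega_1$ carry their order topologies, $(\omega+1)\times\omega_1$ the product topology, and subsets the subspace topology. The proximal game on a uniform space $(X,\mathfrak U)$ (where $\mathfrak U$ is a uniformity or a base for a uniformity): in inning $0$, Player I chooses an entourage $U_0\in\mathfrak U$ and Player II chooses $x_0\in X$. In inning $n+1$, Player I chooses an entourage $U_{n+1}\in\mathfrak U$ with $U_{n+1}\subseteq U_n$ and Player II chooses $x_{n+1}\in U_n[x_n]=\{y\in X:\langle x_n,y\rangle\in U_n\}$. Player I wins if either $\bigcap_{n<\omega}U_n[x_n]=\emptyset$ or the sequence $(x_n:n<\omega)$ converges in $X$; otherwise Player II wins. A space $X$ is semi-proximal if there is a uniformity $\mathfrak U$ on $X$ compatible with its topology such that Player II has no winning strategy in the proximal game on $(X,\mathfrak U)$. *)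

(* Defs.v *)
From HB Require Import structures.
From mathcomp Require Import all_boot all_order.
From mathcomp Require Import wochoice all_classical.
From mathcomp Require Import topology.

Set Implicit Arguments.
Unset Strict Implicit.
Unset Printing Implicit Defensive.

Import Order.TTheory.
Local Open Scope classical_set_scope.

(* The ordinal omega + 1: [Some n] is the finite ordinal n and [None] is the
   top element omega. *)
Definition omega_plus_one : Type := option nat.

HB.instance Definition _ := Choice.on omega_plus_one.

Definition le_omega_plus_one (x y : omega_plus_one) : bool :=
  match x, y with
  | _, None => true
  | None, Some _ => false
  | Some m, Some n => (m <= n)%N
  end.

Fact le_omega_plus_one_refl : reflexive le_omega_plus_one.
Proof. by case=> //= n. Qed.

Fact le_omega_plus_one_anti : antisymmetric le_omega_plus_one.
Proof. by move=> [m|] [n|] //= /anti_leq ->. Qed.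

Fact le_omega_plus_one_trans : transitive le_omega_plus_one.
Proof. by move=> [n|] [m|] [p|] //=; exact: leq_trans. Qed.

Fact le_omega_plus_one_total : total le_omega_plus_one.
Proof. by move=> [m|] [n|] //=; exact: leq_total. Qed.

HB.instance Definition _ := Order.Le_isPOrder.Build (Order.Disp tt tt)
  omega_plus_one le_omega_plus_one_refl le_omega_plus_one_anti
  le_omega_plus_one_trans.

HB.instance Definition _ := Order.POrder_isTotal.Build (Order.Disp tt tt)
  omega_plus_one le_omega_plus_one_total.

(* The ordinal omega_1: fix a well-order of the uncountable set [set nat]; the
   points with countably many strict predecessors form an initial segment of
   order type omega_1, by lemmas [omega1_wf], [omega1_countable] and
   [omega1_uncountable] below. *)
Definition wo_set_nat : rel (set nat) :=
  sval (well_ordering_principle (set nat)).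

Definition omega1 : Type :=
  {x : set nat | `[< countable [set y | wo_set_nat y x /\ y <> x] >]}.

HB.instance Definition _ := Choice.on omega1.

Definition le_omega1 (x y : omega1) : bool := wo_set_nat (val x) (val y).

Fact wo_set_natP : well_order wo_set_nat.
Proof. exact: svalP. Qed.

Fact wo_set_nat_chain : wo_chain wo_set_nat predT.
Proof. by move=> A _; exact: wo_set_natP. Qed.

Fact wo_set_nat_refl : reflexive wo_set_nat.
Proof. by move=> x; exact: (wo_chain_reflexive wo_set_nat_chain). Qed.

Fact wo_set_nat_total : total wo_set_nat.
Proof. by move=> x y; exact: (wo_chainW wo_set_nat_chain). Qed.

Fact wo_set_nat_anti : antisymmetric wo_set_nat.
Proof. by move=> x y; exact: (wo_chain_antisymmetric wo_set_nat_chain). Qed.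

Fact wo_set_nat_trans : transitive wo_set_nat.
Proof.
move=> y x z xy yz.
have [|m [[]]] := @wo_set_natP [pred t | `[< [\/ t = x, t = y | t = z] >]].
  by exists x; apply/asboolP; constructor 1.
have inx : x \in [pred t | `[< [\/ t = x, t = y | t = z] >]].
  by apply/asboolP; constructor 1.
have iny : y \in [pred t | `[< [\/ t = x, t = y | t = z] >]].
  by apply/asboolP; constructor 2.
have inz : z \in [pred t | `[< [\/ t = x, t = y | t = z] >]].
  by apply/asboolP; constructor 3.
move=> /asboolP mE lbm _.
case: mE lbm => -> lbm; first exact: lbm.
- by rewrite (@wo_set_nat_anti x y) // xy lbm.
- by rewrite -(@wo_set_nat_anti y z) // yz lbm.
Qed.

Fact le_omega1_refl : reflexive le_omega1.
Proof. by move=> x; exact: wo_set_nat_refl. Qed.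

Fact le_omega1_anti : antisymmetric le_omega1.
Proof. by move=> x y /wo_set_nat_anti /val_inj. Qed.

Fact le_omega1_trans : transitive le_omega1.
Proof. by move=> y x z; exact: wo_set_nat_trans. Qed.

Fact le_omega1_total : total le_omega1.
Proof. by move=> x y; exact: wo_set_nat_total. Qed.

HB.instance Definition _ := Order.Le_isPOrder.Build (Order.Disp tt tt)
  omega1 le_omega1_refl le_omega1_anti le_omega1_trans.

HB.instance Definition _ := Order.POrder_isTotal.Build (Order.Disp tt tt)
  omega1 le_omega1_total.

Lemma omega1_wf (A : set omega1) :
  A !=set0 -> exists2 m, A m & forall x, A x -> (m <= x)%O.
Proof.
move=> [a Aa].
have [|m [[]]] := @wo_set_natP [pred t | `[< exists2 x, A x & val x = t >]].
  by exists (val a); apply/asboolP; exists a.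
move=> /asboolP[x Ax <-] lbx _; exists x => // y Ay.
by apply: lbx; apply/asboolP; exists y.
Qed.

Lemma omega1_countable (x : omega1) : countable [set y | (y < x)%O].
Proof.
have /asboolP/countable_injP[f f_inj] := valP x.
have lt_val z : (z < x)%O -> wo_set_nat (val z) (val x) /\ val z <> val x.
  by rewrite lt_neqAle => /andP[/eqP zx zlex]; split=> // /val_inj.
apply/countable_injP; exists (f \o val) => y z /set_mem yx /set_mem zx /= fyz.
by apply/val_inj/f_inj => //; apply/mem_set; exact: lt_val.
Qed.

Lemma omega1_uncountable : ~ countable [set: omega1].
Proof.
move=> /countable_injP[f f_inj].
have f_injT x y : f x = f y -> x = y by apply: f_inj; exact: mem_set.
have [t tP] : exists t : set nat, forall x : omega1, val x <> t.
  exists [set n | exists2 x : omega1, f x = n & ~ val x n] => x xE.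
  have xfxE : val x (f x) = (exists2 y, f y = f x & ~ val y (f x)).
    by rewrite {1}xE.
  have [xfx|nxfx] := pselect (val x (f x)).
    by have := xfx; rewrite xfxE => -[y /f_injT ->].
  by apply: (nxfx); rewrite xfxE; exists x.
have [|m [[]]] :=
    @wo_set_natP [pred t | `[< forall x : omega1, val x <> t >]].
  by exists t; apply/asboolP.
move=> /asboolP mP lbm _.
have mE : `[< countable [set y | wo_set_nat y m /\ y <> m] >].
  apply/asboolP/countable_injP.
  exists (fun y => if insub y is Some x then f x else 0).
  move=> y z /set_mem[ym yNm] /set_mem[zm zNm].
  have img u : wo_set_nat u m -> u <> m -> exists x : omega1, val x = u.
    move=> um uNm; apply: contrapT => /forallNP uP; apply: uNm.
    apply: wo_set_nat_anti; rewrite um; apply: lbm; exact/asboolP.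
  have [y' <-] := img y ym yNm; have [z' <-] := img z zm zNm.
  by rewrite !valK => /f_injT ->.
exact: (mP (Sub m mE)).
Qed.

(* [E] is a uniformity on [X]: the entourage axioms of [uniformType]. *)
Section uniformity.
Local Open Scope relation_scope.

Definition uniformity (X : Type) (E : set_system (X * X)) : Prop :=
  [/\ Filter E,
      forall U, E U -> diagonal `<=` U,
      forall U, E U -> E U^-1 &
      forall U, E U -> exists2 V, E V & V \; V `<=` U].

End uniformity.

Definition compatible (X : nbhsType) (E : set_system (X * X)) : Prop :=
  forall x : X, nbhs x = nbhs_ E x.

Lemma entourage_uniformity (X : uniformType) :
  uniformity (@entourage X) /\ compatible (@entourage X).
Proof.
split; last by move=> x; rewrite nbhs_entourageE.
split=> [|U EU [x y] /diagonalP ->|U|U EU].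
- exact: entourage_filter.
- exact: entourage_refl.
- exact: entourage_inv.
- exact: entourage_split_ex.
Qed.

(* The proximal game, for the family of entourages [E]. A play consists of the
   moves [U n] of Player I and [x n] of Player II in each inning [n]; the set
   U[x] is [xsection U x]. *)
Section proximal_game.
Variables (X : topologicalType) (E : set_system (X * X)).

Definition playerI_legal (U : nat -> set (X * X)) : Prop :=
  (forall n, E (U n)) /\ (forall n, U n.+1 `<=` U n).

Definition playerII_legal (U : nat -> set (X * X)) (x : nat -> X) : Prop :=
  forall n, xsection (U n) (x n) (x n.+1).

Definition playerI_wins (U : nat -> set (X * X)) (x : nat -> X) : Prop :=
  \bigcap_n xsection (U n) (x n) = set0 \/ (exists l : X, x @ \oo --> l).

(* In inning n, Player II has seen the moves U_0, ..., U_n of Player I; Player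
   II's own earlier moves are determined by these and the strategy. *)
Definition playerII_strategy : Type := seq (set (X * X)) -> X.

Definition response (s : playerII_strategy) (U : nat -> set (X * X)) :
  nat -> X := fun n => s (mkseq U n.+1).

Definition playerII_winning (s : playerII_strategy) : Prop :=
  forall U, playerI_legal U ->
    playerII_legal U (response s U) /\ ~ playerI_wins U (response s U).

End proximal_game.

Definition semi_proximal (X : topologicalType) : Prop :=
  exists E : set_system (X * X),
    [/\ uniformity E, compatible E &
        ~ exists s : playerII_strategy X, playerII_winning E s].

(* Main.v *)
Require Import Defs.
From mathcomp Require Import all_boot all_order all_classical.
From mathcomp Require Import interval topology.

(* Choose functions [r a : nat -> nat] (a < omega_1), strictly increasing modulo
   finite sets, and index the finite columns by finite sequences. The space has
   the isolated points of omega_1 in column omega, all limits in every finite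
   column, and an isolated [a] in the column of a sequence exactly if the
   sequence is an initial segment of [r a]. It is not normal: a neighborhood of
   column omega contains uncountably many points of one finite column, hence has
   a limit in that column in its closure.

   Player I only plays, in inning n, the entourage comparing the first n entries
   of the branches and the position with respect to n ordinals. Against a winning
   strategy of Player II, a point common to all U_n[x_n]
   - lies above every ordinal played: otherwise the play is confined to a
     countable set, and Player I makes it converge by enumerating that set;
   - is not in a finite column: otherwise Player I, answering each x_n with its
     own height, makes the heights increase to a limit;
   so it is a point of column omega, which Player I can force to be arbitrarily
   high. Two interleaved plays then yield two branches crossing infinitely often,
   contradicting the choice of [r]. *)

Set Implicit Arguments.
Unset Strict Implicit.
Unset Printing Implicit Defensive.

Import Order.TTheory.
Local Open Scope classical_set_scope.

(** * Suprema of sequences, isolated points and limits in [omega1] *)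

Lemma omega1_nonempty : [set: omega1] !=set0.
Proof.
by apply/set0P/eqP => o0; apply: omega1_uncountable; rewrite o0; exact: countable0.
Qed.

Lemma countable_le_omega1 (a : omega1) : countable [set x | (x <= a)%O].
Proof.
have /countable_injP[f f_inj] := omega1_countable a.
apply/countable_injP; exists (fun x => if x == a then 0 else (f x).+1).
move=> x y /set_mem xa /set_mem ya; case: eqVneq => [->|xNa].
  by case: eqVneq => // ->.
case: eqVneq => // yNa [] /f_inj; apply; apply/mem_set => /=.
  by rewrite lt_neqAle xNa.
by rewrite lt_neqAle yNa.
Qed.

(** Otherwise [omega1] would be a countable union of countable initial segments. *)
Lemma omega1_seq_bounded (b : nat -> omega1) : exists d, forall n, (b n < d)%O.
Proof.
apply: contrapT => /forallNP nbd; apply: omega1_uncountable.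
apply: (@sub_countable _ _ _ (\bigcup_n [set x | (x <= b n)%O])).
  apply: subset_card_le => d _; have /existsNP[n /negP nd] := nbd d.
  by exists n => //=; rewrite leNgt.
by apply: bigcup_countable => // n _; exact: countable_le_omega1.
Qed.

Lemma omega1_seq_sup (b : nat -> omega1) :
  exists d, forall x, (d <= x)%O <-> (forall n, (b n <= x)%O).
Proof.
have [d0 bd0] := omega1_seq_bounded b.
have [|d bd dmin] := @omega1_wf [set x | forall n, (b n <= x)%O].
  by exists d0 => n; exact: ltW.
by exists d => x; split=> [dx n|/dmin//]; exact: le_trans (bd n) dx.
Qed.

Lemma omega1_seq_onto_le (a : omega1) :
  exists e : nat -> omega1, forall x, (x <= a)%O -> exists n, e n = x.
Proof.
have /countable_injP[f f_inj] := countable_le_omega1 a.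
pose e n := xget a [set x | (x <= a)%O /\ f x = n].
exists e => x xa; exists (f x); rewrite /e.
case: xgetP => [y _ [ya]|/(_ x)]; last by case.
by move/f_inj; apply; exact/mem_set.
Qed.

(** Minimum or successor: these are exactly the isolated points of the order topology. *)
Definition omega1_isolated (a : omega1) : Prop :=
  (forall b, ~ (b < a)%O) \/
  (exists2 b, (b < a)%O & forall c, ~ (b < c < a)%O).

Lemma omega1_isolated_gt (a : omega1) : exists2 b, (a < b)%O & omega1_isolated b.
Proof.
have [|b /= ab bmin] := @omega1_wf [set b | (a < b)%O].
  by have [d ad] := omega1_seq_bounded (fun=> a); exists d; exact: (ad 0).
exists b => //; right; exists a => // c /andP[/bmin bc].
by rewrite ltNge bc.
Qed.

(** The supremum [l] works: every [b < l] lies below some [c n < l], so [l] is neither the minimum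
    nor a successor. *)
Lemma omega1_increasing_sup (c : nat -> omega1) :
    (forall n, (c n < c n.+1)%O) ->
  exists l, [/\ ~ omega1_isolated l, forall n, (c n < l)%O &
    forall b, (b < l)%O -> exists n, forall m, (n <= m)%N -> (b < c m)%O].
Proof.
move=> c_incr; have [l lP] := omega1_seq_sup c.
have cl n : (c n < l)%O.
  by apply: lt_le_trans (c_incr n) _; exact: (lP l).1.
have cof b : (b < l)%O -> exists n, (b < c n)%O.
  move=> bl; apply: contrapT => /forallNP cb.
  suff : (l <= b)%O by rewrite leNgt bl.
  by apply/lP => n; rewrite leNgt; exact/negP.
exists l; split=> //.
  case=> [/(_ (c 0))|[b /cof[n bn] /(_ (c n))]]; first by apply.
  by rewrite bn cl; apply.
move=> b /cof[n bn]; exists n => m.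
elim: m => [|m IH]; first by rewrite leqn0 => /eqP <-.
rewrite leq_eqVlt => /orP[/eqP <-//|/IH bm]; exact: lt_trans bm (c_incr m).
Qed.

(** * Transfinite recursion and functions increasing modulo finite sets *)

Lemma omega1_ind (P : omega1 -> Prop) :
  (forall a, (forall b, (b < a)%O -> P b) -> P a) -> forall a, P a.
Proof.
move=> IH a; apply: contrapT => nPa.
have [|m /= nPm mmin] := @omega1_wf [set x | ~ P x]; first by exists a.
apply: nPm; apply: IH => b bm; apply: contrapT => /mmin.
by rewrite leNgt bm.
Qed.

Lemma omega1_lt_wf : well_founded (fun a b : omega1 => (a < b)%O).
Proof. by apply: omega1_ind => a IH; constructor. Qed.

(** Diagonalization: with [f b] injecting the predecessors of [b] into [nat], [r b k] is one more
    than the sum of [r a k] over all [a < b] with [f b a <= k]. Hence it exceeds [r a k] as soon as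
    [k] reaches [f b a]. *)
Lemma omega1_scale : exists r : omega1 -> nat -> nat,
  forall a b, (a < b)%O -> exists N, forall k, (N <= k)%N -> (r a k < r b k)%N.
Proof.
have [f f_inj] : exists f : forall a : omega1, omega1 -> nat,
    forall a, {in [set x | (x < a)%O] &, injective (f a)}.
  suff /choice[f fP] : forall a : omega1, exists f : omega1 -> nat,
      {in [set x | (x < a)%O] &, injective f} by exists f.
  by move=> a; apply/countable_injP; exact: omega1_countable.
pose step a (rec : forall b : omega1, (b < a)%O -> nat -> nat) : nat -> nat :=
  fun k => (\sum_(i < k.+1)
    match pselect (exists b, (b < a)%O /\ f a b = i) with
    | left bP => rec (sval (cid bP)) (svalP (cid bP)).1 k
    | right _ => 0
    end).+1%N.
pose r := Fix omega1_lt_wf (fun=> nat -> nat) step.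
have rE a : r a = step a (fun b _ => r b).
  apply: (Fix_eq omega1_lt_wf (fun=> nat -> nat) step) => x g h gh.
  congr step; apply: functional_extensionality_dep => b.
  by apply: functional_extensionality_dep => bx; exact: gh.
exists r => a b ab; exists (f b a) => k abk.
rewrite (rE b) /step ltnS (bigD1 (Ordinal (abk : f b a < k.+1)%N)) //=.
apply: leq_trans _ (leq_addr _ _).
(* By injectivity of [f b], the predecessor chosen for the index [f b a] is [a] itself. *)
case: pselect => [bP|[]]; last by exists a.
case: cid => c /= [cb /f_inj -> //]; exact/mem_set.
Qed.

(** * Neighborhoods in subspaces and in the two order topologies *)

Lemma nbhs_set_typeP (T : topologicalType) (A : set T) (x : set_type A)
    (O : set (set_type A)) :
  nbhs x O <-> exists2 W, nbhs (val x) W & val @^-1` W `<=` O.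
Proof.
split.
  rewrite /nbhs /= => -[_ /= [[W oW <-] /= Wx sWO]].
  by exists W => //; exact: open_nbhs_nbhs.
move=> [W Wx WO].
have : nbhs x (val @^-1` W) by exact: (@initial_continuous (set_type A) T val x W).
exact: filterS.
Qed.

(** Comparison with one cut point [c] is what the entourages below can test. The choice [c = l]
    serves intervals without a lower endpoint, which contain everything below [l]. *)
Lemma order_topology_nbhs_left d (T : orderType d) (l : order_topology T)
    (O : set (order_topology T)) : nbhs l O ->
  exists2 c : T, (c <= l)%O &
    forall y : T, (y <= l)%O -> (y <= c)%O = (l <= c)%O -> O y.
Proof.
rewrite order_nbhs_itv => -[[[[|]a|[|]] [[|]u|[|]]] [oi xi] iO] //.
- move: xi; rewrite in_itv /= => /andP[al lu]; exists a; first exact: ltW.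
  move=> y yl ya; apply: iO => /=; rewrite in_itv /=.
  by rewrite (le_lt_trans yl lu) andbT ltNge ya -ltNge.
- move: xi; rewrite in_itv /= andbT => al; exists a; first exact: ltW.
  by move=> y yl ya; apply: iO => /=; rewrite in_itv /= andbT ltNge ya -ltNge.
- move: xi; rewrite in_itv /= => lu; exists l => // y yl _; apply: iO => /=.
  by rewrite in_itv /= (le_lt_trans yl lu).
- by exists l => // y _ _; apply: iO.
Qed.

Lemma nbhs_omega (O : set (order_topology omega_plus_one)) :
    nbhs (None : order_topology omega_plus_one) O ->
  exists m, forall n, (m <= n)%N -> O (Some n).
Proof.
move=> /order_topology_nbhs_left[[m|] _ mO].
  by exists m.+1 => n mn; apply: mO => //; rewrite /Order.le /= leqNgt mn.
by exists 0 => n _; exact: mO.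
Qed.

Lemma nbhs_omega_tail (m : nat) :
  nbhs (None : order_topology omega_plus_one)
    [set x | if x is Some n then (m <= n)%N else True].
Proof.
apply: (@filterS _ _ _ `](Some m : order_topology omega_plus_one), +oo[%classic).
  by case=> [n|] //=; rewrite in_itv /= andbT => /ltW.
by apply: open_nbhs_nbhs; split; [exact: rray_open|rewrite /= in_itv].
Qed.

Lemma lt_omega_plus_one (m n : nat) :
  ((Some m : omega_plus_one) < Some n)%O = (m < n)%N.
Proof. by rewrite ltNge /Order.le /= -ltnNge. Qed.

Lemma nbhs_finite (n : nat) :
  nbhs (Some n : order_topology omega_plus_one) [set Some n].
Proof.
have ltN k : ((None : omega_plus_one) < Some k)%O = false by rewrite ltNge.
case: n => [|n].
  apply: (@filterS _ _ _ `]-oo, (Some 1 : order_topology omega_plus_one)[%classic).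
    case=> [k|]; rewrite /= in_itv /= ?ltN // lt_omega_plus_one ltnS leqn0.
    by move=> /eqP ->.
  apply: open_nbhs_nbhs; split; first exact: lray_open.
  by rewrite /= in_itv /= lt_omega_plus_one.
apply: (@filterS _ _ _
  `](Some n : order_topology omega_plus_one), (Some n.+2)[%classic).
  case=> [k|]; rewrite /= in_itv /= ?ltN ?andbF // !lt_omega_plus_one !ltnS.
  by move=> nk; congr Some; apply: anti_leq; rewrite andbC.
apply: open_nbhs_nbhs; split; first exact: itv_open.
by rewrite /= in_itv /= !lt_omega_plus_one !ltnS leqnn.
Qed.

(** The set of all [x <= c] is clopen, being also the open ray below the successor of [c]. *)
Lemma nbhs_omega1_le (l c : omega1) :
  nbhs (l : order_topology omega1) [set x | (x <= c)%O = (l <= c)%O].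
Proof.
case: (leP l c) => lc; last first.
  apply: (@filterS _ _ _ `](c : order_topology omega1), +oo[%classic).
    by move=> x /=; rewrite in_itv /= andbT leNgt => ->.
  by apply: open_nbhs_nbhs; split; [exact: rray_open|rewrite /= in_itv /= lc].
have [b cb bmin] : exists2 b, (c < b)%O & forall x, (c < x)%O -> (b <= x)%O.
  have [d cd] := omega1_seq_bounded (fun=> c).
  by apply: omega1_wf; exists d; exact: (cd 0).
apply: (@filterS _ _ _ `]-oo, (b : order_topology omega1)[%classic).
  by move=> x /=; rewrite in_itv /= leNgt => xb; apply/negP => /bmin; rewrite leNgt xb.
by apply: open_nbhs_nbhs; split; [exact: lray_open|rewrite /= in_itv /= (le_lt_trans lc cb)].
Qed.

(** * The branch space and a compatible uniformity *)

Lemma initial_segment_bounded (f : nat -> nat) m :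
  exists b, forall n, (n < m)%N -> (f n < b)%N.
Proof.
elim: m => [|m [b IH]]; first by exists 0.
exists (maxn b (f m).+1) => n; rewrite ltnS leq_eqVlt leq_max => /orP[/eqP ->|/IH ->//].
by rewrite ltnSn orbT.
Qed.

Section branch_space.
Variable r : omega1 -> nat -> nat.

Definition branch_node (a : omega1) (n : nat) : Prop :=
  CodeSeq.decode n = mkseq (r a) (size (CodeSeq.decode n)).

Definition branch_space :
    set (order_topology omega_plus_one * order_topology omega1) :=
  [set x | if x.1 is Some n then omega1_isolated x.2 -> branch_node x.2 n
           else omega1_isolated x.2].

Local Notation X := (set_type branch_space).

(** In column omega the branch is all of [r a], so the level has length exactly [k]. In a finite
    column it may be shorter, and then it is the whole sequence of that column. *)
Definition level (k : nat) (x : X) : seq nat :=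
  if (val x).1 is Some n then take k (CodeSeq.decode n) else mkseq (r (val x).2) k.

Definition height (x : X) : omega1 := (val x).2.

(** One list codes both parameters: its length is the number of branch entries compared, its members
    are the cut points for the heights. Each of these sets is an equivalence relation. *)
Definition branch_entourage (d : seq omega1) : set (X * X) :=
  [set xy | level (size d) xy.1 = level (size d) xy.2 /\
     forall c, c \in d -> (height xy.1 <= c)%O = (height xy.2 <= c)%O].

Lemma take_mkseq T (f : nat -> T) m n : (m <= n)%N -> take m (mkseq f n) = mkseq f m.
Proof.
by move=> mn; rewrite /mkseq -map_take take_iota (minn_idPl mn).
Qed.

Lemma take_level m n x : (m <= n)%N -> take m (level n x) = level m x.
Proof.
by move=> mn; rewrite /level; case: (val x).1 => [i|]; [rewrite take_takel|rewrite take_mkseq].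
Qed.

(** A level of length less than [k] cannot come from column omega or from truncating a longer
    sequence. *)
Lemma level_finite k x n : (val x).1 = Some n ->
  (size (CodeSeq.decode n) < k)%N ->
  forall y, level k x = level k y -> (val y).1 = Some n.
Proof.
move=> xn nk y; rewrite /level xn take_oversize; last exact: ltnW.
case: (val y).1 => [i|] E; last by move: nk; rewrite E size_mkseq ltnn.
congr Some; apply: (can_inj CodeSeq.decodeK); rewrite E.
case: (ltnP k (size (CodeSeq.decode i))) => ik; last by rewrite take_oversize.
by move: nk; rewrite E size_takel ?ltnn // ltnW.
Qed.

Lemma branch_nbhs_entourage (x : X) (O : set X) :
  nbhs x O -> exists d, forall y, branch_entourage d (x, y) -> O y.
Proof.
move=> /nbhs_set_typeP[W [[P Q] /= [Px Qx] PQW] WO].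
have [c cx cQ] := order_topology_nbhs_left Qx.
suff [k kP] : exists k, forall y, level k x = level k y -> P (val y).1.
  (* The cut at [height x] keeps [y] at most as high as [x]. The copies of [c] supply the other cut
     and make the list long enough to compare [k] entries; [k.+1] copies ensure that [c] occurs even
     if [k = 0]. *)
  exists (height x :: nseq k.+1 c) => y [/= Lxy hxy]; apply: WO; apply: PQW.
  split => /=.
    have kS : (k <= (size (nseq k c)).+2)%N by rewrite size_nseq ltnW // ltnW.
    by apply: kP; rewrite -!(take_level _ kS) Lxy.
  apply: cQ.
    by have := hxy (height x); rewrite mem_head lexx => /(_ isT)/esym.
  by apply/esym/(hxy c); rewrite !in_cons eqxx orbT.
case E : (val x).1 => [n|].
  exists (size (CodeSeq.decode n)).+1 => y Lxy.
  by rewrite (level_finite E (ltnSn _) Lxy) -E; exact: nbhs_singleton Px.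
move: Px; rewrite E => /[dup] /nbhs_singleton PN /nbhs_omega[m mP].
(* Every column before [m] has a sequence shorter than [k], so a level of length [k] places [y] in
   column [m] or later. *)
have [k kP] := initial_segment_bounded (fun n => size (CodeSeq.decode n)) m.
exists k => y; rewrite /level E; case: (val y).1 => // n /(congr1 size).
rewrite size_mkseq => kn; apply: mP; rewrite leqNgt; apply/negP => /kP /= nk.
by move: nk; rewrite ltnNge {1}kn size_take_min geq_minr.
Qed.

Lemma omega1_isolated_nbhs (l : omega1) : omega1_isolated l ->
  nbhs (l : order_topology omega1) [set l].
Proof.
case=> [lmin|[c cl cmax]].
  apply: filterS (nbhs_omega1_le l l) => x /=; rewrite lexx le_eqVlt.
  by case/orP => [/eqP//|/lmin].
apply: filterS (filterI (nbhs_omega1_le l l) (nbhs_omega1_le l c)) => x /= [].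
rewrite lexx le_eqVlt => /orP[/eqP//|xl]; rewrite (leNgt l) cl /= => xc.
by have /negP := cmax x; rewrite ltNge xc xl.
Qed.

Lemma branch_entourage_nbhs (x : X) (d : seq omega1) :
  nbhs x [set y | branch_entourage d (x, y)].
Proof.
have hd : nbhs x [set y : X | forall c, c \in d ->
    (height x <= c)%O = (height y <= c)%O].
  elim: d => [|c d IH]; first exact: filterS filterT.
  have hc : nbhs x [set y : X | (height y <= c)%O = (height x <= c)%O].
    apply/nbhs_set_typeP.
    exists (setT `*` [set b | (b <= c)%O = (height x <= c)%O]); last by move=> y [].
    exists (setT, [set b | (b <= c)%O = (height x <= c)%O]) => //; split=> /=.
      exact: filterT.
    exact: nbhs_omega1_le.
  apply: filterS (filterI hc IH) => y [/= yc yd] b.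
  by rewrite in_cons => /orP[/eqP -> //|/yd].
suff hl : nbhs x [set y : X | level (size d) x = level (size d) y].
  by apply: filterS (filterI hl hd) => y [].
move: (size d) => k; apply/nbhs_set_typeP.
case E : (val x).1 => [n|].
  exists ([set Some n] `*` setT).
    exists ([set Some n], setT) => //; split=> /=; last exact: filterT.
    by rewrite E; exact: nbhs_finite.
  by move=> y /= [yn _]; rewrite /level E yn.
have xi : omega1_isolated (height x).
  by have := set_valP x; rewrite /branch_space /= -set_valE E.
(* The bound [m] exceeds the codes of all initial segments shorter than [k]. At the fixed isolated
   height, a column from [m] on therefore carries an initial segment of length at least [k]. *)
have [m mP] := initial_segment_bounded
  (fun j => CodeSeq.code (mkseq (r (height x)) j)) k.
exists ([set a | if a is Some n then (m <= n)%N else True] `*` [set height x]).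
  exists ([set a : omega_plus_one | if a is Some n then (m <= n)%N else True],
          [set height x]) => //.
  split=> /=; first by rewrite E; exact: nbhs_omega_tail.
  exact: omega1_isolated_nbhs.
move=> y /= [my yx]; rewrite /level E.
have := set_valP y; rewrite /branch_space /= -set_valE yx.
case: (val y).1 my => // n mn /(_ xi) nE.
rewrite nE take_mkseq // leqNgt; apply/negP => /mP /=.
by rewrite -nE CodeSeq.decodeK ltnNge mn.
Qed.

Definition branch_uniformity : set_system (X * X) :=
  [set V | exists d, branch_entourage d `<=` V].

Lemma branch_entourage_cat d e :
  branch_entourage (d ++ e) `<=` branch_entourage d `&` branch_entourage e.
Proof.
move=> [x y] [/= L H]; split; split=> /=.
- by rewrite -!(@take_level (size d) (size (d ++ e))) ?L // size_cat leq_addr.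
- by move=> c cd; apply: H; rewrite mem_cat cd.
- by rewrite -!(@take_level (size e) (size (d ++ e))) ?L // size_cat leq_addl.
- by move=> c ce; apply: H; rewrite mem_cat ce orbT.
Qed.

Lemma branch_entourage_refl d x : branch_entourage d (x, x).
Proof. by split. Qed.

Lemma branch_entourage_sym d x y :
  branch_entourage d (x, y) -> branch_entourage d (y, x).
Proof. by move=> [L H]; split=> // c /H. Qed.

Lemma branch_entourage_trans d x y z :
  branch_entourage d (x, y) -> branch_entourage d (y, z) -> branch_entourage d (x, z).
Proof. by move=> [/= L H] [/= M G]; split=> /= [|c cd]; [rewrite L|rewrite H ?G]. Qed.

Lemma branch_uniformityP : uniformity branch_uniformity.
Proof.
split.
- split.
  + by exists [::].
  + move=> V W [d dV] [e eW]; exists (d ++ e) => xy /branch_entourage_cat[/dV ? /eW].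
    by split.
  + by move=> V W VW [d dV]; exists d => xy /dV /VW.
- by move=> V [d dV] [x y] /diagonalP ->; exact/dV/branch_entourage_refl.
- by move=> V [d dV]; exists d => -[x y] /branch_entourage_sym /dV.
- move=> V [d dV]; exists (branch_entourage d); first by exists d.
  by move=> [x z] [y /= xy yz]; apply/dV/(branch_entourage_trans xy yz).
Qed.

Lemma branch_uniformity_compatible : compatible branch_uniformity.
Proof.
move=> x; apply/seteqP; split=> O /=.
  move=> /branch_nbhs_entourage[d dO]; exists (branch_entourage d); first by exists d.
  by move=> y /xsectionP /dO.
move=> [V [d dV] VO]; apply: filterS (branch_entourage_nbhs x d) => y dxy.
by apply: VO; apply/xsectionP/dV.
Qed.

End branch_space.

(** * Infinite sequences built from finite ones *)

Lemma prefix_limit (T : eqType) (x0 : T) (h : nat -> seq T) :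
    (forall n, prefix (h n) (h n.+1)) -> (forall n, (n <= size (h n))%N) ->
  exists f, forall n, mkseq f (size (h n)) = h n.
Proof.
(* Entry [i] is read from [h i.+1], the first term sure to be long enough. *)
move=> hpre hsize; exists (fun i => nth x0 (h i.+1) i).
have mono m n : (m <= n)%N -> prefix (h m) (h n).
  elim: n => [|n IH]; first by rewrite leqn0 => /eqP ->; exact: prefix_refl.
  by rewrite leq_eqVlt => /orP[/eqP ->|/IH /prefix_trans]; [exact: prefix_refl|apply].
have nth_h m n i : (i < size (h m))%N -> (m <= n)%N -> nth x0 (h m) i = nth x0 (h n) i.
  by move=> im /mono/prefixP[s ->]; rewrite nth_cat im.
move=> n; apply: (@eq_from_nth _ x0); rewrite size_mkseq // => i ih.
rewrite nth_mkseq //; case: (leqP n i.+1) => ni; first by rewrite (nth_h n i.+1).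
by rewrite (nth_h i.+1 n) // ltnW.
Qed.

(** This lets Player I start with the moves [d] and then react to the whole history through [F]. *)
Lemma mkseq_recursion (T : eqType) (F : seq T -> T) (d : seq T) : exists f,
  mkseq f (size d) = d /\ forall m, (size d <= m)%N -> f m = F (mkseq f m).
Proof.
pose h m := iter m (fun e => rcons e (F e)) d.
have sizeh m : size (h m) = (size d + m)%N.
  by elim: m => [|m IH]; rewrite /h /= ?addn0 // size_rcons IH addnS.
have [||f fh] := @prefix_limit _ (F d) h.
- by move=> m; rewrite /h /= prefix_rcons.
- by move=> m; rewrite sizeh leq_addl.
have {}fh m : mkseq f (size d + m) = h m by rewrite -sizeh fh.
exists f; split; first by rewrite -[X in mkseq _ X]addn0 fh.
move=> m dm; rewrite -(subnKC dm) fh.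
by have := fh (m - size d).+1; rewrite addnS mkseqS /= fh => /rcons_inj[].
Qed.

(** * Outcomes of plays against a winning strategy *)

Section branch_game.
Variable r : omega1 -> nat -> nat.
Local Notation X := (set_type (branch_space r)).

Lemma branch_entourage_prefix (d e : seq omega1) : prefix d e ->
  @branch_entourage r e `<=` branch_entourage d.
Proof. by move=> /prefixP[s ->] xy /branch_entourage_cat[]. Qed.

Lemma branch_entourage_level d (x y : X) k :
  branch_entourage d (x, y) -> (k <= size d)%N -> level k x = level k y.
Proof. by move=> [/= L _] kd; rewrite -!(take_level _ kd) L. Qed.

Lemma branch_cvg (x : nat -> X) (l : X) :
    (forall k, exists m, forall n, (m <= n)%N -> level k (x n) = level k l) ->
    (forall c, exists m, forall n, (m <= n)%N ->
      (height (x n) <= c)%O = (height l <= c)%O) ->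
  x @ \oo --> l.
Proof.
move=> xlevel xheight O /branch_nbhs_entourage[d dO].
suff [m mP] : exists m, forall n, (m <= n)%N -> branch_entourage d (l, x n).
  by exists m => // n /= /mP /dO.
have [m1 m1P] := xlevel (size d).
suff [m2 m2P] : exists m, forall n, (m <= n)%N -> forall c, c \in d ->
    (height l <= c)%O = (height (x n) <= c)%O.
  exists (maxn m1 m2) => n; rewrite geq_max => /andP[n1 n2].
  by split=> [|c cd] /=; rewrite ?m1P // (m2P n n2).
elim: d {dO m1P} => [|c d [m2 IH]]; first by exists 0.
have [m3 m3P] := xheight c.
exists (maxn m3 m2) => n; rewrite geq_max => /andP[n3 n2] b.
by rewrite in_cons => /orP[/eqP ->|/(IH n n2)//]; rewrite m3P.
Qed.

(** The supremum of the heights is a limit ordinal, and every limit belongs to every finite column;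
    levels are constant along a column. *)
Lemma branch_column_cvg (x : nat -> X) (t n : nat) :
    (forall m, (n <= m)%N -> (val (x m)).1 = Some t) ->
    (forall m, (n <= m)%N -> (height (x m) < height (x m.+1))%O) ->
  exists2 q : X, ~ omega1_isolated (height q) & x @ \oo --> q.
Proof.
move=> xt x_incr.
have [|l [l_lim hl h_cof]] := @omega1_increasing_sup (fun m => height (x (n + m))).
  by move=> m; rewrite addnS; apply: x_incr; exact: leq_addr.
have qX : branch_space r (Some t, l) by move=> /l_lim.
exists (exist (fun x => x \in branch_space r) _ (mem_set qX)) => //.
apply: branch_cvg => [k|c].
  by exists n => m nm; rewrite /level (xt m nm).
have [lc|cl] := leP l c.
  by exists n => m nm; rewrite -(subnKC nm); exact: le_trans (ltW (hl _)) lc.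
have [m0 m0P] := h_cof c cl.
exists (n + m0)%N => m nm; have nm' := leq_trans (leq_addr _ _) nm.
by rewrite -(subnKC nm'); apply/lt_geF/m0P; rewrite -(leq_add2l n) subnKC.
Qed.

(* Player I's play is coded by a sequence [g] of ordinals; [z d] is Player II's
   reply to the entourages coded by the initial segments of [d], [d] included. *)
Definition outcome (z : seq omega1 -> X) (g : nat -> omega1) (p : X) : Prop :=
  forall n, branch_entourage (mkseq g n) (z (mkseq g n), p).

Definition winning_answer (z : seq omega1 -> X) : Prop :=
  forall g : nat -> omega1,
  [/\ forall n, branch_entourage (mkseq g n) (z (mkseq g n), z (mkseq g n.+1)),
      exists p, outcome z g p &
      forall l : X, ~ ((fun n => z (mkseq g n)) @ \oo --> l)].

Variable z : seq omega1 -> X.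
Hypothesis zwin : winning_answer z.

Lemma answer_mono g m n : (m <= n)%N ->
  branch_entourage (mkseq g m) (z (mkseq g m), z (mkseq g n)).
Proof.
have [zg _ _] := zwin g.
elim: n => [|n IH]; first by rewrite leqn0 => /eqP ->; exact: branch_entourage_refl.
rewrite leq_eqVlt => /orP[/eqP ->|mn]; first exact: branch_entourage_refl.
apply: branch_entourage_trans (IH mn) _.
apply: (@branch_entourage_prefix _ (mkseq g n)) (zg n).
by rewrite -(take_mkseq g (mn : (m <= n)%N)) prefix_take.
Qed.

Lemma outcome_height g p : outcome z g p -> forall n, (g n < height p)%O.
Proof.
move=> gp n; rewrite ltNge; apply/negP => pn.
have [e e_onto] := omega1_seq_onto_le (g n).
(* The modified play agrees with [g] up to entry [n] and then enumerates all ordinals up to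
   [g n]. *)
pose g' i := if (i <= n)%N then g i else e (i - n.+1)%N.
have gE : mkseq g' n.+1 = mkseq g n.+1.
  by apply/eq_in_map => i; rewrite mem_iota /= add0n ltnS /g' => ->.
(* The cut at [g n] has been played and [p] lies on its lower side, so every later position does
   too. *)
have bnd q : branch_entourage (mkseq g n.+1) (z (mkseq g n.+1), q) ->
    (height q <= g n)%O.
  move=> /branch_entourage_sym qz; have := branch_entourage_trans qz (gp n.+1).
  move=> [_ /(_ (g n))] /= ->//; apply/mapP; exists n => //.
  by rewrite mem_iota /= add0n ltnSn.
have [_ [p' gp'] ncvg] := zwin g'; apply: (ncvg p'); apply: branch_cvg => [k|c].
  exists k => m km; apply: (branch_entourage_level (gp' m)).
  by rewrite size_mkseq.
have p'n : (height p' <= g n)%O by apply: bnd; rewrite -gE.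
have [nc|cn] := leP (g n) c.
  exists n.+1 => m nm; rewrite (le_trans p'n nc); apply: le_trans nc.
  by apply: bnd; rewrite -gE; exact: answer_mono.
(* A cut [c] below [g n] is entry [n.+1 + i] of the new play, so from the next inning on all
   positions lie on the same side of it as [p']. *)
have [i ei] := e_onto c (ltW cn).
exists (n.+1 + i).+1 => m im; have [_ /(_ c)] := gp' m; apply.
apply/mapP; exists (n.+1 + i)%N; first by rewrite mem_iota.
by rewrite /g' leqNgt leq_addr /= addKn.
Qed.

Lemma outcome_infinite g p : outcome z g p -> (val p).1 = None.
Proof.
move=> gp; case E : (val p).1 => [t|//]; exfalso.
have [n tn] : exists n, (size (CodeSeq.decode t) < n)%N by eexists; exact: ltnSn.
(* After [n] entries, which pin the play to column [t], Player I answers each position with its own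
   height. *)
have [f []] := mkseq_recursion (fun d => height (z d)) (mkseq g n).
rewrite size_mkseq => fg f_rec.
have [_ [p' fp'] ncvg] := zwin f.
have [m nm|m nm|q _ /ncvg//] := @branch_column_cvg (fun m => z (mkseq f m)) t n.
  have /branch_entourage_sym := answer_mono f nm; rewrite fg => zm.
  apply: (level_finite E tn); apply/esym.
  apply: (branch_entourage_level (branch_entourage_trans zm (gp n))).
  by rewrite size_mkseq.
(* The outcome [p'] lies above the cut [f m], hence so does the next position, while [f m] is the
   height of the present one. *)
rewrite -(f_rec m nm) ltNge; have [_ /(_ (f m)) /= ->] := fp' m.+1.
  by rewrite -ltNge; exact: outcome_height.
by rewrite mkseqS mem_rcons mem_head.
Qed.

Lemma outcome_gt (d : seq omega1) (a : omega1) : exists g p,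
  [/\ mkseq g (size d) = d, outcome z g p & (a < height p)%O].
Proof.
(* Beyond [d] the default value [a] is played, so [outcome_height] at entry [size d] puts [p] above
   [a]. *)
pose g := nth a d; have [_ [p gp] _] := zwin g.
exists g, p; split=> //; first exact: mkseq_nth.
by have := outcome_height gp (size d); rewrite /g nth_default.
Qed.

(** * Interleaving two plays *)

Hypothesis r_scale : forall a b, (a < b)%O ->
  exists N, forall k, (N <= k)%N -> (r a k < r b k)%N.

(** Continue [d] to an outcome [p1] and [e] to a higher outcome [p2]; their branches are strictly
    ordered at some large [k]. Cutting both plays at a length [M > k] fixes entry [k] of the branch
    of every point of column omega still available. *)
Lemma answer_pair_lt (d e : seq omega1) (N : nat) : exists d' e',
  [/\ prefix d d', prefix e e', (N <= size d')%N, (N <= size e')%N &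
    forall p q : X, (val p).1 = None -> (val q).1 = None ->
      branch_entourage d' (z d', p) -> branch_entourage e' (z e', q) ->
    exists2 k, (N <= k)%N & (r (height p) k < r (height q) k)%N].
Proof.
have [g1 [p1 [g1d gp1 _]]] := outcome_gt d (height (z [::])).
have [g2 [p2 [g2e gp2 p12]]] := outcome_gt e (height p1).
have [K rK] := r_scale p12.
pose k := maxn K N; pose M := (k.+1 + size d + size e)%N.
have kM : (k < M)%N by rewrite /M -addnA leq_addr.
have dM : (size d <= M)%N by rewrite /M -addnA addnCA leq_addr.
have eM : (size e <= M)%N by rewrite /M leq_addl.
have NM : (N <= M)%N by apply: leq_trans (ltnW kM); exact: leq_maxr.
have node g p1' p : outcome z g p1' -> (val p).1 = None ->
    branch_entourage (mkseq g M) (z (mkseq g M), p) ->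
    r (height p) k = r (height p1') k.
  move=> gp1' pN /branch_entourage_sym pz.
  have := branch_entourage_level (branch_entourage_trans pz (gp1' M)) (leqnn _).
  rewrite /level pN (outcome_infinite gp1') size_mkseq.
  by move=> /(congr1 (nth 0 ^~ k)); rewrite !nth_mkseq.
exists (mkseq g1 M), (mkseq g2 M); rewrite !size_mkseq; split=> //.
- by rewrite -{1}g1d -(take_mkseq g1 dM) prefix_take.
- by rewrite -{1}g2e -(take_mkseq g2 eM) prefix_take.
- move=> p q pN qN pz qz; exists k; first exact: leq_maxr.
  by rewrite (node _ _ _ gp1 pN pz) (node _ _ _ gp2 qN qz) rK // leq_maxl.
Qed.

(** Any finite list begins some play, so the answers to [d] and [e] are related by [answer_mono]. *)
Lemma answer_coherent d e p : prefix d e ->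
  branch_entourage e (z e, p) -> branch_entourage d (z d, p).
Proof.
move=> de; have /prefixP[s eE] := de.
have eg : mkseq (nth (height p) e) (size e) = e := mkseq_nth _ _.
have dg : mkseq (nth (height p) e) (size d) = d.
  by rewrite -(take_mkseq _ (size_prefix de)) eg eE take_size_cat.
move=> /(branch_entourage_prefix de).
apply: branch_entourage_trans.
by have := answer_mono (nth (height p) e) (size_prefix de); rewrite dg eg.
Qed.

Lemma no_winning_answer : False.
Proof.
have cross (s : seq omega1 * seq omega1) : exists s' : seq omega1 * seq omega1,
    [/\ prefix s.1 s'.1, prefix s.2 s'.2,
      (size s.1 < size s'.1)%N, (size s.2 < size s'.2)%N &
      forall p q : X, (val p).1 = None -> (val q).1 = None ->
        branch_entourage s'.1 (z s'.1, p) -> branch_entourage s'.2 (z s'.2, q) ->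
      (exists2 k, (size s.1 <= k)%N & (r (height p) k < r (height q) k)%N) /\
      (exists2 k, (size s.1 <= k)%N & (r (height q) k < r (height p) k)%N)].
  case: s => d e; pose N := (size d + size e).+1.
  have dN : (size d < N)%N by rewrite ltnS leq_addr.
  have eN : (size e < N)%N by rewrite ltnS leq_addl.
  have [d1 [e1 [dd1 ee1 _ _ lt1]]] := answer_pair_lt d e N.
  (* The roles of the two plays are exchanged to obtain the reverse inequality; the first one
     survives by [answer_coherent]. *)
  have [e2 [d2 [ee2 dd2 Ne2 Nd2 lt2]]] := answer_pair_lt e1 d1 N.
  exists (d2, e2); split=> /=.
  - exact: prefix_trans dd2.
  - exact: prefix_trans ee2.
  - exact: leq_trans dN Nd2.
  - exact: leq_trans eN Ne2.
  - move=> p q pN qN pz qz; split.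
      have [k Nk] := lt1 _ _ pN qN (answer_coherent dd2 pz) (answer_coherent ee2 qz).
      by exists k => //; exact: leq_trans (ltnW dN) Nk.
    have [k Nk] := lt2 _ _ qN pN qz pz.
    by exists k => //; exact: leq_trans (ltnW dN) Nk.
have [next nextP] := choice cross.
pose h n := iter n next ([::], [::]).
have hsize n : (n <= size (h n).1)%N /\ (n <= size (h n).2)%N.
  elim: n => [//|n [IH1 IH2]]; have [_ _ s1 s2 _] := nextP (h n).
  by split; [exact: leq_ltn_trans s1|exact: leq_ltn_trans s2].
have [|n|g1 g1E] := @prefix_limit _ (height (z [::])) (fun n => (h n).1).
- by move=> n; have [] := nextP (h n).
- by have [] := hsize n.
have [|n|g2 g2E] := @prefix_limit _ (height (z [::])) (fun n => (h n).2).
- by move=> n; have [] := nextP (h n).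
- by have [] := hsize n.
have [_ [p gp] _] := zwin g1; have [_ [q gq] _] := zwin g2.
have pq n : (exists2 k, (n <= k)%N & (r (height p) k < r (height q) k)%N) /\
            (exists2 k, (n <= k)%N & (r (height q) k < r (height p) k)%N).
  have [_ _ _ _] := nextP (h n).
  have := gp (size (h n.+1).1); have := gq (size (h n.+1).2).
  rewrite g1E g2E => qz pz.
  move=> /(_ p q (outcome_infinite gp) (outcome_infinite gq) pz qz).
  have [nh _] := hsize n.
  by case=> -[k hk kpq] [k' hk' kqp]; split; [exists k|exists k'] => //;
    exact: leq_trans nh _.
(* Distinct heights would order the two branches eventually, and equal heights would make some entry
   smaller than itself. *)
have [lt_pq|lt_qp|E] := ltgtP (height p) (height q).
- have [N rN] := r_scale lt_pq; have [_ [k Nk]] := pq N.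
  by rewrite ltnNge ltnW // rN.
- have [N rN] := r_scale lt_qp; have [[k Nk]] := pq N.
  by rewrite ltnNge ltnW // rN.
- by have [[k _]] := pq 0; rewrite E ltnn.
Qed.
End branch_game.

(** * Failure of normality, and semi-proximality *)

Theorem branch_space_not_normal (r : omega1 -> nat -> nat) :
  ~ normal_space (set_type (branch_space r)).
Proof.
set X := set_type _ => nX.
pose H : set X := [set x | (val x).1 = None].
pose O : set X := [set x | omega1_isolated (height x)].
have cH : closed H.
  rewrite -openC openE => x; rewrite /H /=; case E : (val x).1 => [n|//] _.
  have := branch_entourage_nbhs x (nseq (size (CodeSeq.decode n)).+1 (height x)).
  apply: filterS => y [/= Lxy _]; rewrite size_nseq in Lxy.
  by rewrite (level_finite E (ltnSn _) Lxy).
have HO : set_nbhs H O.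
  move=> x /= xN; have xi : omega1_isolated (height x).
    by have := set_valP x; rewrite /branch_space /= -set_valE xN.
  apply/nbhs_set_typeP; exists (setT `*` [set height x]).
    exists (setT, [set height x]) => //; split=> /=; first exact: filterT.
    exact: omega1_isolated_nbhs.
  by move=> y [_ /= yx]; rewrite /O /= /height yx.
(* Normality yields a neighborhood [C] of column omega whose closure contains only points of
   isolated height. *)
have [C HC CO] := nX H cH O HO.
have node a : omega1_isolated a ->
    exists n (y : X), [/\ (val y).1 = Some n, height y = a & C y].
  move=> ai; have pX : branch_space r (None, a) by [].
  pose p : X := exist (fun x => x \in branch_space r) _ (mem_set pX).
  have [d dC] := branch_nbhs_entourage (HC p erefl).
  pose n := CodeSeq.code (mkseq (r a) (size d)).
  have yX : branch_space r (Some n, a).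
    by move=> _; rewrite /branch_node CodeSeq.codeK size_mkseq.
  pose y : X := exist (fun x => x \in branch_space r) _ (mem_set yX).
  exists n, y; split=> //; apply: dC; split=> //.
  by rewrite /level /= CodeSeq.codeK take_oversize ?size_mkseq.
(* Pigeonhole: if [C] were bounded in each finite column, the countably many bounds would have a
   common bound [d], and [node] fails at an isolated ordinal above [d]. *)
have [n nP] : exists n, forall b, exists y : X,
    [/\ (val y).1 = Some n, (b < height y)%O & C y].
  apply: contrapT => /forallNP bounded.
  have /choice[b bP] : forall n, exists b : omega1, forall y : X,
      (val y).1 = Some n -> C y -> (height y <= b)%O.
    move=> n; have /existsNP[b bP] := bounded n; exists b => y yn Cy.
    by rewrite leNgt; apply/negP => yb; apply: bP; exists y.
  have [d db] := omega1_seq_bounded b.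
  have [a da /node[n [y [yn ya /(bP n y yn)]]]] := omega1_isolated_gt d.
  by rewrite ya leNgt (lt_trans (db n) da).
have [f fP] := choice nP.
have [a _] := omega1_nonempty.
pose y m := iter m (f \o @height r) (f a).
have yC m : (val (y m)).1 = Some n /\ C (y m).
  by case: m => [|m]; rewrite /y /=; [have [] := fP a|have [] := fP (height (y m))].
have [m _|m _|q q_lim yq] := @branch_column_cvg r y n 0.
- by have [] := yC m.
- by have [] := fP (height (y m)).
(* The limit [q] of points of [C] in column [n] lies in the closure of [C], but its height is not
   isolated. *)
apply/q_lim/CO => B /yq[m _ mB]; exists (y m).
by split; [have [] := yC m|exact: mB (leqnn m)].
Qed.

Theorem branch_space_semi_proximal (r : omega1 -> nat -> nat) :
    (forall a b, (a < b)%O -> exists N, forall k, (N <= k)%N -> (r a k < r b k)%N) ->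
  semi_proximal (set_type (branch_space r)).
Proof.
move=> r_scale; exists (@branch_uniformity r); split.
- exact: branch_uniformityP.
- exact: branch_uniformity_compatible.
move=> [s sP].
(* In inning [size d] Player II has seen [(size d).+1] entourages, coded by the prefixes of [d] from
   the empty one to [d] itself. *)
pose z d := s (mkseq (fun i => branch_entourage (take i d)) (size d).+1).
apply: (@no_winning_answer r z) => // g.
pose U n := @branch_entourage r (mkseq g n).
have Us n : z (mkseq g n) = response s U n.
  rewrite /z /response size_mkseq; congr s; apply/eq_in_map => i.
  by rewrite mem_iota /= add0n ltnS => ni; rewrite take_mkseq.
have [|legal nwins] := sP U.
  split=> n; first by exists (mkseq g n).
  by apply: branch_entourage_prefix; rewrite -(take_mkseq g (leqnSn n)) prefix_take.
split.
- by move=> n; rewrite !Us; exact/xsectionP/legal.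
- apply: contrapT => nout; apply: nwins; left; apply/seteqP; split=> // p pU.
  by apply: nout; exists p => n; rewrite Us; apply/xsectionP/pU.
- move=> l zl; apply: nwins; right; exists l.
  by apply: cvg_trans zl; rewrite (_ : response s U = fun n => z (mkseq g n)) //;
    apply/funext => n; rewrite Us.
Qed.

Theorem mainTheorem3 :
  exists A : set (order_topology omega_plus_one * order_topology omega1)%type,
    semi_proximal (set_type A) /\ ~ normal_space (set_type A).
Proof.
have [r r_scale] := omega1_scale; exists (branch_space r); split.
  exact: branch_space_semi_proximal.
exact: branch_space_not_normal.
Qed.
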